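(* Let $\mathcal B$ be a measurable Bratteli diagram with levels represented by $\sigma$-finite measure spaces $(X_n,\mathcal A_n,\nu_n)$, $n\ge0$. Suppose that $(P_n)$ and $(Q_n)$ are sequences of dual probability transition kernels compatible with $\mathcal B$. Let $F=(F_n)$ be a function with $F_n\in L^2(\nu_n)$ for every $n$. Then $F$ belongs to the finite energy space $\mathcal H_E$ if and only if $$\sum_{n\ge0}\Big(\|F_n\|^2_{L^2(\nu_n)}-2\langle F_n,T_{P_n}(F_{n+1})\rangle_{L^2(\nu_n)}+\|F_{n+1}\|^2_{L^2(\nu_{n+1})}\Big)<\infty .$$
   Context: A measurable Bratteli diagram $\mathcal B=(X_n,E_n)_{n\ge0}$ consists of standard Borel spaces $(X_n,\mathcal A_n)$, each Borel isomorphic to a fixed uncountable standard Borel space, and Borel subsets $E_n\subset X_n\times X_{n+1}$ such that the projections $s:E_n\to X_n$ and $r:E_n\to X_{n+1}$ are onto Borel maps. A probability transition kernel $P_n:X_n\times\mathcal A_{n+1}\to[0,1]$ satisfies: $x\mapsto P_n(x,C)$ is Borel for every $C\in\mathcal A_{n+1}$ and $P_n(x,\cdot)$ is a probability measure for every $x\in X_n$; similarly $Q_n:X_{n+1}\times\mathcal A_n\to[0,1]$. Compatibility with $\mathcal B$ means that $P_n(x,\cdot)$ is carried by $r(s^{-1}(x))$, and $Q_n(y,\cdot)$ by $s(r^{-1}(y))$. $(P_n,Q_n)$ is a dual pair if $d\nu_n(x)P_n(x,dy)=d\nu_{n+1}(y)Q_n(y,dx)$ as measures on $X_n\times X_{n+1}$;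 this common measure is denoted $\rho_n$. $T_{P_n}:L^2(\nu_{n+1})\to L^2(\nu_n)$ is the operator $T_{P_n}(g)(x)=\int_{X_{n+1}}P_n(x,dy)g(y)$. The finite energy space $\mathcal H_E$ consists of sequences $F=(F_n)$ of real Borel functions $F_n$ on $X_n$ (modulo constants) with $$\|F\|^2_{\mathcal H_E}=\sum_{n=0}^\infty\iint_{X_n\times X_{n+1}}\big(F_n(x)-F_{n+1}(y)\big)^2\,d\rho_n(x,y)<\infty .$$ *)

(* Defs.v *)
From HB Require Import structures.
From mathcomp Require Import all_boot all_order all_algebra.
From mathcomp Require Import all_classical all_reals all_analysis.

Set Implicit Arguments.
Unset Strict Implicit.
Unset Printing Implicit Defensive.

Import Order.TTheory GRing.Theory Num.Theory.
Import numFieldNormedType.Exports.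

Local Open Scope classical_set_scope.
Local Open Scope ring_scope.

Definition borel_isomorphic (d d' : measure_display)
    (X : measurableType d) (Y : measurableType d') : Prop :=
  exists (f : X -> Y) (g : Y -> X),
    [/\ cancel f g, cancel g f,
        measurable_fun [set: X] f & measurable_fun [set: Y] g].

(* A complete metric space is a Hausdorff complete pseudometric space. *)
Definition standard_borel (R : realType) (d : measure_display)
    (X : measurableType d) : Prop :=
  exists T : completePseudoMetricType R,
    [/\ hausdorff_space T,
        exists2 D : set T, countable D & dense D &
        borel_isomorphic X (g_sigma_algebraType (@open T))].

Record measurable_bratteli_diagram (R : realType) (d : nat -> measure_display)
    (X : forall n, measurableType (d n))
    (E : forall n, set (X n * X n.+1)) : Prop := {
  levels_standard : forall n, standard_borel R (X n) ;
  levels_isomorphic : exists (d0 : measure_display) (Z : measurableType d0),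
    [/\ standard_borel R Z, ~ countable [set: Z] &
        forall n, borel_isomorphic (X n) Z] ;
  edges_borel : forall n, measurable (E n) ;
  edges_source_onto : forall n, fst @` E n = [set: X n] ;
  edges_range_onto : forall n, snd @` E n = [set: X n.+1]
}.

Section edges.
Context (S T : Type) (E : set (S * T)).

(* r(s^-1(x)) *)
Definition targets (x : S) : set T := snd @` (E `&` fst @^-1` [set x]).

(* s(r^-1(y)) *)
Definition sources (y : T) : set S := fst @` (E `&` snd @^-1` [set y]).

End edges.

Definition carried_by (R : realType) (d : measure_display)
    (X : measurableType d) (mu : {measure set X -> \bar R}) (A : set X) : Prop :=
  mu.-negligible (~` A).

Section edge_measure.
Local Open Scope ereal_scope.
Context (R : realType) (d d' : measure_display)
  (X : measurableType d) (Y : measurableType d').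
Variables (nu : {sigma_finite_measure set X -> \bar R}) (P : R.-pker X ~> Y).

(* dnu(x) P(x,dy) *)
Definition edge_measure (A : set (X * Y)) : \bar R :=
  \int[nu]_x P x (xsection A x).

Let edge_measure0 : edge_measure set0 = 0.
Proof. by apply: integral0_eq => x _; rewrite xsection0 measure0. Qed.

Let edge_measure_ge0 A : 0 <= edge_measure A.
Proof. by apply: integral_ge0 => x _; exact: measure_ge0. Qed.

Let edge_measure_semi_sigma_additive : semi_sigma_additive edge_measure.
Proof.
move=> F mF tF mUF.
rewrite [X in _ --> X](_ : _ = \sum_(n <oo) edge_measure (F n)).
  by apply/cvg_closeP; split; [exact: is_cvg_nneseries|rewrite closeE].
rewrite /edge_measure -integral_nneseries//; last first.
  move=> n; apply: (measurable_fun_xsection_finite_kernel P).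
  exact: mem_set.
apply: eq_integral => x _; apply/esym/cvg_lim => //=; rewrite xsection_bigcup.
apply: (measure_sigma_additive _ (trivIset_xsection tF)) => ?.
exact: measurable_xsection.
Qed.

HB.instance Definition _ := isMeasure.Build _ _ _ edge_measure
  edge_measure0 edge_measure_ge0 edge_measure_semi_sigma_additive.

End edge_measure.

(* dnu'(y) Q(y,dx), as a set function on X * Y *)
Definition reverse_edge_measure (R : realType) (d d' : measure_display)
    (X : measurableType d) (Y : measurableType d')
    (nu' : {sigma_finite_measure set Y -> \bar R}) (Q : R.-pker Y ~> X)
    (A : set (X * Y)) : \bar R :=
  (\int[nu']_y Q y (ysection A y))%E.

Definition dual_pair (R : realType) (d d' : measure_display)
    (X : measurableType d) (Y : measurableType d')
    (nu : {sigma_finite_measure set X -> \bar R})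
    (nu' : {sigma_finite_measure set Y -> \bar R})
    (P : R.-pker X ~> Y) (Q : R.-pker Y ~> X) : Prop :=
  forall A : set (X * Y), measurable A ->
    edge_measure nu P A = reverse_edge_measure nu' Q A.

Definition transition_op (R : realType) (d d' : measure_display)
    (X : measurableType d) (Y : measurableType d')
    (P : R.-pker X ~> Y) (g : Y -> R) : X -> R :=
  fun x => \int[P x]_y g y.

Section L2.
Context (R : realType) (d : measure_display) (X : measurableType d).
Variable nu : {measure set X -> \bar R}.

Definition L2norm (f : X -> R) : R := fine ('N[nu]_2%:E[EFin \o f])%E.

Definition L2inner (f g : X -> R) : R := \int[nu]_x (f x * g x).

End L2.

Section finite_energy.
Context (R : realType) (d : nat -> measure_display)
  (X : forall n, measurableType (d n)).
Variables (nu : forall n, {sigma_finite_measure set (X n) -> \bar R})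
  (P : forall n, R.-pker (X n) ~> (X n.+1)).

Definition energy (F : forall n, X n -> R) : \bar R :=
  (\sum_(0 <= n <oo)
     \int[edge_measure (nu n) (P n)]_z ((F n z.1 - F n.+1 z.2) ^+ 2)%:E)%E.

(* Functions on the diagram are identified when they differ by one constant,
   the same on every level. *)
Definition mod_constants (F : forall n, X n -> R) : set (forall n, X n -> R) :=
  [set G | exists c : R, forall n x, G n x = F n x + c].

Definition finite_energy_space : set (set (forall n, X n -> R)) :=
  [set mod_constants F | F in
    [set F : forall n, X n -> R |
      (forall n, measurable_fun [set: X n] (F n)) /\ (energy F < +oo)%E]].

End finite_energy.

(* Main.v *)
Require Import Defs.
From HB Require Import structures.
From mathcomp Require Import all_boot all_order all_algebra.
From mathcomp Require Import all_classical all_reals all_analysis.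
From mathcomp Require Import measurable_realfun.
From mathcomp Require Import ring lra.

(* Fubini for the edge measure [rho = dnu(x) P(x,dy)] shows that its first marginal
   is [nu], because [P x] has mass 1, and duality with [Q] shows in the same way
   that its second marginal is [nu']. Hence [f(x)] and [g(y)] lie in [L2(rho)]
   with the norms they have on the levels, [\int f(x) g(y) drho = <f, T_P g>], and
   expanding the square identifies the two series term by term; their sum does
   not depend on the representative of [F] modulo constants. *)

Set Implicit Arguments.
Unset Strict Implicit.
Unset Printing Implicit Defensive.

Import Order.TTheory GRing.Theory Num.Theory.
Import numFieldNormedType.Exports.
Local Open Scope classical_set_scope.
Local Open Scope ring_scope.

(** * Fubini theorem and marginals for the edge measure *)

Section edge_measure_integral.
Local Open Scope ereal_scope.
Context (R : realType) (d d' : measure_display)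
  (X : measurableType d) (Y : measurableType d').
Variables (nu : {sigma_finite_measure set X -> \bar R}) (P : R.-pker X ~> Y).

Import HBNNSimple.

Lemma integral_edge_measure_indic (A : set (X * Y)) : measurable A ->
  \int[edge_measure nu P]_z (\1_A z)%:E =
  \int[nu]_x \int[P x]_y (\1_A (x, y))%:E.
Proof.
move=> mA; rewrite integral_indic// setIT; apply: eq_integral => x _.
rewrite (_ : (fun y => (\1_A (x, y))%:E) = EFin \o \1_(xsection A x)).
  by rewrite integral_indic ?setIT//; exact: measurable_xsection.
by apply/funext => y/=; rewrite !indicE mem_xsection.
Qed.

(** A simple function is a finite sum over its range of multiples of indicators, so linearity on
    both sides reduces the claim to indicators. *)
Lemma integral_edge_measure_nnsfun (f : {nnsfun (X * Y) >-> R}) :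
  \int[edge_measure nu P]_z (f z)%:E = \int[nu]_x \int[P x]_y (f (x, y))%:E.
Proof.
pose g (r : R) (z : X * Y) : \bar R := (r * \1_(f @^-1` [set r]) z)%:E.
have fE z : (f z)%:E = \sum_(r \in range f) g r z.
  by rewrite fimfunE -fsumEFin.
have g0 r z : 0 <= g r z by rewrite /g EFinM nnfun_muleindic_ge0.
have mg r : measurable_fun [set: X * Y] (g r).
  exact/measurable_EFinP/measurableT_comp.
have mg2 r x : measurable_fun [set: Y] (fun y => g r (x, y)).
  exact: measurableT_comp.
under eq_integral do rewrite fE.
rewrite ge0_integral_fsum//.
under [RHS]eq_integral => x _.
  under eq_integral do rewrite fE.
  rewrite ge0_integral_fsum//; over.
rewrite /= ge0_integral_fsum//; last 2 first.
- by move=> r; exact: measurable_fun_integral_finite_kernel.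
- by move=> r x _; exact: integral_ge0.
(* The scalar can be pulled out only if it is nonnegative; for [r < 0] the level set of [f] is empty
   and both sides vanish. *)
apply: eq_fsbigr => r _; have [r0|r0] := leP 0%R r; last first.
  have g00 z : g r z = 0 by rewrite /g preimage_nnfun0// indic0 mulr0.
  rewrite [LHS]integral0_eq//; apply/esym/integral0_eq => x _.
  exact: integral0_eq.
have gE z : g r z = r%:E * (\1_(f @^-1` [set r]) z)%:E by rewrite /g EFinM.
under [LHS]eq_integral do rewrite gE.
rewrite ge0_integralZl//; last exact/measurable_EFinP.
rewrite integral_edge_measure_indic// -ge0_integralZl//; last 2 first.
- apply: (measurable_fun_integral_finite_kernel
    (fun z => (\1_(f @^-1` [set r]) z)%:E) P) => //.
  exact/measurable_EFinP.
- by move=> x _; apply: integral_ge0 => y _; rewrite lee_fin.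
apply: eq_integral => x _; under [RHS]eq_integral do rewrite gE.
rewrite ge0_integralZl//.
by apply/measurable_EFinP; exact: measurableT_comp.
Qed.

(** Tonelli by simple approximation from below: monotone convergence is applied for [rho], then for
    [nu], then for each [P x]. *)
Lemma ge0_integral_edge_measure (f : X * Y -> \bar R) :
  (forall z, 0 <= f z) -> measurable_fun [set: _] f ->
  \int[edge_measure nu P]_z f z = \int[nu]_x \int[P x]_y f (x, y).
Proof.
move=> f0 mf; pose f_ := nnsfun_approx measurableT mf.
have ndf z : nondecreasing_seq (fun n => (f_ n z)%:E).
  by move=> a b ab; rewrite lee_fin; exact/lefP/nd_nnsfun_approx.
have f_0 n z : 0 <= (f_ n z)%:E by rewrite lee_fin.
have mf_ n : measurable_fun [set: X * Y] (fun z => (f_ n z)%:E).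
  exact/measurable_EFinP.
have mf_2 n x : measurable_fun [set: Y] (fun y => (f_ n (x, y))%:E).
  exact/measurable_EFinP/measurableT_comp.
have fE z : f z = limn (fun n => (f_ n z)%:E).
  by apply/esym/cvg_lim => //; exact: cvg_nnsfun_approx.
under eq_integral do rewrite fE.
rewrite monotone_convergence//.
under eq_fun do rewrite integral_edge_measure_nnsfun.
rewrite -monotone_convergence//; last 3 first.
- by move=> n; exact: (measurable_fun_integral_finite_kernel
    (fun z => (f_ n z)%:E) P).
- by move=> n x _; exact: integral_ge0.
- by move=> x _ a b ab; apply: ge0_le_integral => // y _; exact: ndf.
apply: eq_integral => x _; rewrite -monotone_convergence//.
by apply: eq_integral => y _; rewrite fE.
Qed.

Lemma ge0_integral_edge_measure_fst (f : X -> \bar R) :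
  (forall x, 0 <= f x) -> measurable_fun [set: _] f ->
  \int[edge_measure nu P]_z f z.1 = \int[nu]_x f x.
Proof.
move=> f0 mf; rewrite ge0_integral_edge_measure//; last first.
  exact: measurableT_comp.
by apply: eq_integral => x _ /=; rewrite integral_cst// prob_kernel mule1.
Qed.

Lemma ge0_integral_edge_measure_snd
    (nu' : {sigma_finite_measure set Y -> \bar R}) (Q : R.-pker Y ~> X)
    (f : Y -> \bar R) :
  dual_pair nu nu' P Q -> (forall y, 0 <= f y) -> measurable_fun [set: _] f ->
  \int[edge_measure nu P]_z f z.2 = \int[nu']_y f y.
Proof.
move=> PQ f0 mf.
transitivity (\int[pushforward (edge_measure nu P) snd]_y f y).
  by rewrite (ge0_integral_pushforward measurable_snd).
apply: eq_measure_integral => A mA _; rewrite /= /pushforward.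
have mA2 : measurable (snd @^-1` A : set (X * Y)).
  by rewrite -[_ @^-1` _]setTI; exact: measurable_snd.
rewrite PQ// /reverse_edge_measure.
transitivity (\int[nu']_y (\1_A y)%:E); last by rewrite integral_indic// setIT.
apply: eq_integral => y _; rewrite indicE.
have [yA|yA] := boolP (y \in A).
  rewrite (_ : ysection _ y = setT) ?prob_kernel//.
  by apply/seteqP; split => x//= _; rewrite /ysection/= inE;
    exact: set_mem.
rewrite (_ : ysection _ y = set0) ?measure0//.
apply/seteqP; split => x//=; rewrite /ysection/= inE => Ay.
by rewrite mem_set in yA.
Qed.

Lemma ge0_integrable_integral_kernel (f : X * Y -> \bar R) :
  (forall z, 0 <= f z) ->
  (edge_measure nu P).-integrable [set: _] f ->
  nu.-integrable [set: _] (fun x => \int[P x]_y f (x, y)).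
Proof.
move=> f0 fi; have mf := measurable_int _ fi.
apply/integrableP; split; first exact: measurable_fun_integral_finite_kernel.
under eq_integral do rewrite gee0_abs ?integral_ge0//.
by rewrite -ge0_integral_edge_measure//; exact: integrable_lty fi.
Qed.

(** Valid at every [x] without integrability, because positive and negative parts commute with
    taking sections. *)
Lemma integral_kernelE (f : X * Y -> \bar R) x :
  \int[P x]_y f (x, y) =
  \int[P x]_y f^\+ (x, y) - \int[P x]_y f^\- (x, y).
Proof.
rewrite integralE; congr (_ - _); apply: eq_integral => y _.
- by rewrite !funeposE.
- by rewrite !funenegE.
Qed.

Lemma integrable_integral_kernel (f : X * Y -> \bar R) :
  (edge_measure nu P).-integrable [set: _] f ->
  nu.-integrable [set: _] (fun x => \int[P x]_y f (x, y)).
Proof.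
move=> fi; under [X in integrable _ _ X]eq_fun do rewrite integral_kernelE.
by apply: integrableB => //; apply: ge0_integrable_integral_kernel => //;
  [exact: integrable_funepos|exact: integrable_funeneg].
Qed.

(** Tonelli applies to [f^\+] and [f^\-] separately; both iterated integrals are integrable, so
    their difference may be integrated termwise. *)
Lemma integral_edge_measure (f : X * Y -> \bar R) :
  (edge_measure nu P).-integrable [set: _] f ->
  \int[edge_measure nu P]_z f z = \int[nu]_x \int[P x]_y f (x, y).
Proof.
move=> fi; have mf := measurable_int _ fi.
under [RHS]eq_integral do rewrite integral_kernelE.
rewrite [LHS]integralE [RHS]integralB//; last 2 first.
- by apply: ge0_integrable_integral_kernel => //; exact: integrable_funepos.
- by apply: ge0_integrable_integral_kernel => //; exact: integrable_funeneg.
by rewrite !ge0_integral_edge_measure//;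
  [exact: measurable_funeneg|exact: measurable_funepos].
Qed.

Lemma measurable_integral_kernel (g : Y -> \bar R) :
  measurable_fun [set: _] g -> measurable_fun [set: _] (fun x => \int[P x]_y g y).
Proof.
move=> mg; under eq_fun do rewrite integralE.
have mgk (h : Y -> \bar R) : (forall y, 0 <= h y) -> measurable_fun [set: _] h ->
    measurable_fun [set: _] (fun x => \int[P x]_y h y).
  move=> h0 mh.
  apply: (measurable_fun_integral_finite_kernel (fun z => h z.2) P) => //.
  exact: measurableT_comp.
by apply: emeasurable_funB; apply: mgk => //;
  [exact: measurable_funepos|exact: measurable_funeneg].
Qed.

End edge_measure_integral.

(** * Functions in L2 of a measure *)

Lemma Lfun_measurable (R : realType) (d : measure_display) (X : measurableType d)
    (nu : {measure set X -> \bar R}) (p : \bar R) (f : X -> R) :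
  f \in Lfun nu p -> measurable_fun [set: X] f.
Proof. by rewrite inE => /andP[]; rewrite !inE. Qed.

(** Membership in L2 makes the norm finite, so [fine] in [L2norm] loses nothing. *)
Lemma L2norm_sqr (R : realType) (d : measure_display) (X : measurableType d)
    (nu : {measure set X -> \bar R}) (f : X -> R) : f \in Lfun nu 2%:E ->
  (L2norm nu f ^+ 2)%:E = (\int[nu]_x (f x ^+ 2)%:E)%E.
Proof.
rewrite inE => /andP[_]; rewrite inE/= => f2.
have N0 := Lnorm_ge0 nu 2%:E (EFin \o f).
rewrite -powR_mulrn ?fine_ge0// -poweR_EFin fineK ?ge0_fin_numE//.
rewrite poweR_Lnorm//; apply: eq_integral => x _ /=.
by rewrite powR_mulrn// real_normK// num_real.
Qed.

(** * From L2 of the levels to L2 of the edge measure *)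

Section dual_pair_L2.
Context (R : realType) (d d' : measure_display)
  (X : measurableType d) (Y : measurableType d').
Variables (nu : {sigma_finite_measure set X -> \bar R})
  (nu' : {sigma_finite_measure set Y -> \bar R})
  (P : R.-pker X ~> Y) (Q : R.-pker Y ~> X).
Hypothesis PQ : dual_pair nu nu' P Q.
Let rho := edge_measure nu P.

Lemma Lfun2_fst (f : X -> R) : f \in Lfun nu 2%:E ->
  (fun z => f z.1) \in Lfun rho 2%:E.
Proof.
rewrite !inE => /andP[]; rewrite !inE/= => mf; rewrite /finite_norm => f2.
apply/andP; split; rewrite inE/=; first exact: measurableT_comp.
(* The two norms are in fact equal: the first marginal of [rho] is [nu]. *)
rewrite /finite_norm (le_lt_trans _ f2)// unlock.
rewrite (ge0_integral_edge_measure_fst nu P (f := fun x => `|(f x)%:E| `^ 2)%E)//.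
- by move=> x; exact: poweR_ge0.
- apply: (measurableT_comp (measurable_poweR _)) => //.
  exact/measurableT_comp/measurable_EFinP.
Qed.

Lemma Lfun2_snd (g : Y -> R) : g \in Lfun nu' 2%:E ->
  (fun z => g z.2) \in Lfun rho 2%:E.
Proof.
rewrite !inE => /andP[]; rewrite !inE/= => mg; rewrite /finite_norm => g2.
apply/andP; split; rewrite inE/=; first exact: measurableT_comp.
rewrite /finite_norm (le_lt_trans _ g2)// unlock.
rewrite (ge0_integral_edge_measure_snd PQ
  (f := fun x => `|(g x)%:E| `^ 2)%E)//.
- by move=> x; exact: poweR_ge0.
- apply: (measurableT_comp (measurable_poweR _)) => //.
  exact/measurableT_comp/measurable_EFinP.
Qed.

(** Needed because [transition_op] applies [fine], which sends an infinite integral to 0. The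
    integral of [g(y)^2] over [rho] is finite, hence so is its inner integral at almost every
    [x]. *)
Lemma ae_integrable_kernel (g : Y -> R) : g \in Lfun nu' 2%:E ->
  {ae nu, forall x, (P x).-integrable [set: _] (EFin \o g)}.
Proof.
move=> g2; have mg := Lfun_measurable g2.
(* [g] is in [L2(P x)], hence in [L1(P x)], as soon as [\int g^2 dP x] is finite. *)
have := integrable_ae measurableT
  (integrable_integral_kernel (Lfun2_integrable_sqr (Lfun2_snd g2))).
apply: filterS => x /(_ Logic.I) /= gx.
have g2x : (P x).-integrable setT (fun y => (g y ^+ 2)%:E).
  apply/integrableP; split.
    by apply/measurable_EFinP; exact: measurable_funX.
  under eq_integral do rewrite gee0_abs ?lee_fin ?sqr_ge0//.
  by rewrite ltey_eq gx.
have i1 : (P x).-integrable setT (cst 1%E).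
  apply/integrableP; split => //.
  by rewrite /= normr1 integral_cst// prob_kernel mule1 ltry.
(* Domination by [|g| <= 1 + g ^+ 2]. *)
apply: (le_integrable measurableT _ _ (integrableD measurableT i1 g2x)).
  exact/measurable_EFinP.
move=> y _ /=; rewrite lee_fin [leRHS]ger0_norm ?addr_ge0 ?sqr_ge0//.
rewrite -real_normK ?num_real//; move: (normr_ge0 (g y)); nra.
Qed.

(** The product of two L2 functions is integrable over [rho], so Fubini applies and [f x] leaves the
    inner integral. *)
Lemma integral_mul_transition_op (f : X -> R) (g : Y -> R) :
  f \in Lfun nu 2%:E -> g \in Lfun nu' 2%:E ->
  (\int[rho]_z (f z.1 * g z.2)%:E)%E =
  (L2inner nu f (transition_op P g))%:E.
Proof.
move=> f2 g2.
have mf := Lfun_measurable f2.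
have mg := Lfun_measurable g2.
have /Lfun1_integrable fgi := Lfun2_mul_Lfun1 (Lfun2_fst f2) (Lfun2_snd g2).
rewrite /L2inner /Rintegral.
have <- : (\int[rho]_z (f z.1 * g z.2)%:E =
    \int[nu]_x (f x * transition_op P g x)%:E)%E.
  rewrite integral_edge_measure//; apply: ae_eq_integral => //.
  - exact: measurable_int (integrable_integral_kernel fgi).
  - apply/measurable_EFinP; apply: measurable_funM => //.
    apply: (measurableT_comp (fine_measurable _)) => //.
    by apply: measurable_integral_kernel; exact/measurable_EFinP.
  (* Only where [g] is integrable for [P x] is [transition_op P g x] known to be the inner integral,
     hence an equality almost everywhere. *)
  - apply: filterS (ae_integrable_kernel g2) => x gx _ /=.
    under eq_integral do rewrite EFinM.
    by rewrite integralZl// EFinM fineK//; exact: integrable_fin_num gx.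
by rewrite fineK//; exact: integrable_fin_num fgi.
Qed.

Lemma integral_edge_measure_sqrB (f : X -> R) (g : Y -> R) :
  f \in Lfun nu 2%:E -> g \in Lfun nu' 2%:E ->
  (\int[rho]_z ((f z.1 - g z.2) ^+ 2)%:E)%E =
  (L2norm nu f ^+ 2 - 2 * L2inner nu f (transition_op P g)
    + L2norm nu' g ^+ 2)%:E.
Proof.
move=> f2 g2.
have mf := Lfun_measurable f2.
have mg := Lfun_measurable g2.
have fi := Lfun2_integrable_sqr (Lfun2_fst f2).
have gi := Lfun2_integrable_sqr (Lfun2_snd g2).
have /Lfun1_integrable fgi := Lfun2_mul_Lfun1 (Lfun2_fst f2) (Lfun2_snd g2).
(* All three terms are integrable over [rho], so the expanded square splits with no indeterminate
   difference. *)
transitivity (\int[rho]_z ((f z.1 ^+ 2)%:E - 2%:E * (f z.1 * g z.2)%:E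
    + (g z.2 ^+ 2)%:E))%E.
  apply: eq_integral => z _; rewrite -EFinM -EFinB -EFinD; congr EFin; ring.
have fgi2 := integrableZl measurableT 2 fgi.
rewrite integralD//; last exact: integrableB.
rewrite integralB// integralZl// integral_mul_transition_op//.
rewrite [RHS]EFinD [in RHS]EFinB !L2norm_sqr// [in RHS]EFinM; congr (_ - _ + _)%E.
- rewrite (ge0_integral_edge_measure_fst nu P (f := fun x => (f x ^+ 2)%:E))//.
    by move=> x; rewrite lee_fin sqr_ge0.
  by apply/measurable_EFinP; exact: measurable_funX.
- rewrite (ge0_integral_edge_measure_snd PQ (f := fun x => (g x ^+ 2)%:E))//.
    by move=> x; rewrite lee_fin sqr_ge0.
  by apply/measurable_EFinP; exact: measurable_funX.
Qed.

End dual_pair_L2.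

(** * Energy modulo constants, and the equivalence *)

Lemma energy_addr (R : realType) (d : nat -> measure_display)
    (X : forall n, measurableType (d n))
    (nu : forall n, {sigma_finite_measure set (X n) -> \bar R})
    (P : forall n, R.-pker (X n) ~> (X n.+1)) (F G : forall n, X n -> R) (c : R) :
  (forall n x, G n x = F n x + c) -> energy nu P G = energy nu P F.
Proof.
move=> GF; apply: eq_eseriesr => n _; apply: eq_integral => z _.
by rewrite !GF opprD addrACA subrr addr0.
Qed.

Theorem proposition8p15 (R : realType) (d : nat -> measure_display)
    (X : forall n, measurableType (d n))
    (E : forall n, set (X n * X n.+1))
    (nu : forall n, {sigma_finite_measure set (X n) -> \bar R})
    (P : forall n, R.-pker (X n) ~> (X n.+1))
    (Q : forall n, R.-pker (X n.+1) ~> (X n))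
    (F : forall n, X n -> R) :
  measurable_bratteli_diagram R E ->
  (forall n x, carried_by (P n x) (targets (E n) x)) ->
  (forall n y, carried_by (Q n y) (sources (E n) y)) ->
  (forall n, dual_pair (nu n) (nu n.+1) (P n) (Q n)) ->
  (forall n, F n \in Lfun (nu n) 2%:E) ->
  finite_energy_space nu P (mod_constants F) <->
  (\sum_(0 <= n <oo)
     (L2norm (nu n) (F n) ^+ 2
      - 2 * L2inner (nu n) (F n) (transition_op (P n) (F n.+1))
      + L2norm (nu n.+1) (F n.+1) ^+ 2)%:E < +oo)%E.
Proof.
move=> _ _ _ PQ F2.
rewrite (_ : (\sum_(0 <= n <oo) _)%E = energy nu P F); last first.
  apply: eq_eseriesr => n _.
  by rewrite (integral_edge_measure_sqrB (PQ n)).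
split=> [[G [_ GE] FG]|FE].
  (* [G] is in its own class, with constant 0, and this class is that of [F]. *)
  have [c GF] : mod_constants F G.
    by rewrite -FG; exists 0 => n x; rewrite addr0.
  by rewrite -(energy_addr nu P GF).
by exists F => //; split => // n; exact: Lfun_measurable (F2 n).
Qed.
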